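(* An infinite tree $T$ has infinite endomorphism motion (i.e. every nonidentity endomorphism of $T$ moves infinitely many vertices) if and only if $T$ has no pendant vertices (vertices of degree $1$).
   Context: An endomorphism of a simple graph $G=(V,E)$ is a map $\phi: V\to V$ such that $\phi(u)\phi(v)\in E$ whenever $uv\in E$. A vertex $v$ is moved by $\phi$ if $\phi(v)\neq v$. The endomorphism motion of $G$ is the minimum over nonidentity endomorphisms of the number of moved vertices. *)

(* Defs.v *)
From mathcomp Require Import all_boot.
From mathcomp Require Import boolp classical_sets functions cardinality.

Set Implicit Arguments.
Unset Strict Implicit.
Unset Printing Implicit Defensive.

Local Open Scope classical_set_scope.

(* The vertex type may be infinite, of any cardinality, and the graph need not
   be locally finite.  Classically every type is an eqType and every relation
   is boolean, so this is no restriction. *)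
Record sgraph := SGraph {
  vertex :> eqType;
  adj : rel vertex;
  adj_sym : symmetric adj;
  adj_irr : irreflexive adj
}.
Arguments adj {s} : rename.

Definition connected_graph (G : sgraph) : Prop :=
  forall u v : G, exists2 p : seq G, path adj u p & last u p = v.

(* A [ucycle] is a closed walk with distinct vertices; those of size 2 are
   single edges traversed back and forth, hence the bound. *)
Definition acyclic_graph (G : sgraph) : Prop :=
  forall c : seq G, ucycle adj c -> size c < 3.

Definition is_tree (G : sgraph) : Prop :=
  [/\ inhabited G, connected_graph G & acyclic_graph G].

Definition infinite_graph (G : sgraph) : Prop := infinite_set [set: G].

Definition endomorphism (G : sgraph) (phi : G -> G) : Prop :=
  forall u v : G, adj u v -> adj (phi u) (phi v).

Definition moved (G : sgraph) (phi : G -> G) : set G := [set v | phi v <> v].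

Definition infinite_endomorphism_motion (G : sgraph) : Prop :=
  forall phi : G -> G, endomorphism phi -> phi <> id ->
    infinite_set (moved phi).

Definition neighbours (G : sgraph) (v : G) : set G := [set u | adj v u].

Definition pendant (G : sgraph) (v : G) : Prop := (neighbours v #= `I_1)%card.

(* Main.v *)
(* Suppose that phi moves only finitely many vertices and that there are no
   pendant vertices. Any vertex v lies on a simple path whose endpoints are both
   fixed by phi: extend the path reduced to v at both ends until this happens.
   The image of that path is a walk of the same length between the same
   endpoints, which in a tree must be the path itself, so phi fixes v.
   Conversely, a pendant vertex can be folded onto another neighbour of its
   unique neighbour, moving only that one vertex. *)
Require Import Defs.
From mathcomp Require Import all_boot.
From mathcomp Require Import boolp classical_sets functions cardinality.

Set Implicit Arguments.
Unset Strict Implicit.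

(** If [y] came later on the path, the segment from [x] to [y] closed up by the edge [xy] would be a
    cycle with at least three vertices. *)
Lemma acyclic_adj_path (G : sgraph) (x y : G) (p : seq G) :
  acyclic_graph G -> path adj x p -> uniq (x :: p) -> adj x y ->
  y \in x :: p -> y = head x p.
Proof.
move=> acG xp up xy; rewrite inE => /orP[/eqP yx|yp].
  by rewrite yx adj_irr in xy.
case/splitPr: yp xp up => p1 p2 xp up.
have /acG : ucycle adj (x :: rcons p1 y).
  rewrite /ucycle /= !rcons_path last_rcons (adj_sym y) xy andbT.
  move: xp up; rewrite -cat_rcons cat_path rcons_path -cat_cons cat_uniq.
  by move=> /andP[-> _] /and3P[].
by case: p1 {xp up} => [|z p1] //=; rewrite size_rcons.
Qed.

Lemma acyclic_uniq_path (G : sgraph) (x : G) (p q : seq G) :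
  acyclic_graph G -> path adj x p -> uniq (x :: p) ->
  path adj x q -> uniq (x :: q) -> last x p = last x q -> p = q.
Proof.
move=> acG; elim: p x q => [|y p IHp] x q.
  case: q => [|z q] //= _ _ _ /andP[xq _] xE.
  by rewrite xE mem_last in xq.
move=> /= /andP[xy yp] /andP[xNp up] xq uq pq.
(* If [y] avoids [x :: q], then [x :: q] is itself a simple path out of [y] with the same end as
   [p]. By induction it is [p], which would then revisit [x]. *)
have [yq|yNq] := boolP (y \in x :: q); last first.
  have pE : p = x :: q.
    by apply: (IHp y) => //=; [rewrite adj_sym xy|rewrite yNq].
  by rewrite pE !inE eqxx orbT in xNp.
have := acyclic_adj_path acG xq uq xy yq.
case: q xq uq pq {yq} => [|z q] /=.
  by move=> _ _ _ yx; rewrite yx adj_irr in xy.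
move=> /andP[_ zq] /andP[_ uq] pq yz; rewrite -{}yz in zq uq pq *.
by rewrite (IHp y q).
Qed.

(** Shortening the walk [q] to a simple path gives [p], so [q] visits every vertex of [p]. Having
    the same length, it has no room for a repetition and is simple too. *)
Lemma acyclic_walk_eq (G : sgraph) (x : G) (p q : seq G) :
  acyclic_graph G -> path adj x p -> uniq (x :: p) -> path adj x q ->
  last x p = last x q -> size p = size q -> p = q.
Proof.
move=> acG xp up xq pq spq; apply: (acyclic_uniq_path acG xp up xq _ pq).
case: (shortenP xq) pq => q' xq' uq' sq'.
move=> /(acyclic_uniq_path acG xp up xq' uq') pE.
apply: (leq_size_uniq up); last by rewrite /= spq.
by move=> y; rewrite !inE pE => /orP[->//|/sq' ->]; rewrite orbT.
Qed.

Lemma connected_has_neighbour (G : sgraph) (v : G) :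
  connected_graph G -> infinite_graph G -> exists u : G, adj v u.
Proof.
move=> conG infG; apply: contrapT => vN; apply: infG.
apply: (@sub_finite_set _ _ [set v]%classic); last exact: finite_set1.
move=> w _ /=; have [[|u p] /=] := conG v w; first by [].
by move=> /andP[vu _]; case: vN; exists u.
Qed.

Lemma pendant_neighboursE (G : sgraph) (v : G) :
  pendant v -> exists2 u : G, adj v u & forall w : G, adj v w -> w = u.
Proof.
move=> /card_set_bijP[f [ffun finj fsurj]].
have [u vu _] := fsurj 0 erefl; exists u => // w vw.
apply: finj; rewrite ?inE //.
have := ffun _ vu; have := ffun _ vw.
by rewrite /= !ltnS !leqn0 => /eqP-> /eqP->.
Qed.

(** Here [u] is arbitrary, not necessarily a neighbour of [v]. Were it the only candidate, the
    nonempty set of neighbours would be the singleton of [u]. *)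
Lemma no_pendant_other_neighbour (G : sgraph) (v u : G) :
  connected_graph G -> infinite_graph G -> ~ pendant v ->
  exists2 w : G, adj v w & w <> u.
Proof.
move=> conG infG vNp; apply: contrapT => wN; apply: vNp.
have vu (w : G) : adj v w -> w = u.
  by move=> vw; apply: contrapT => wu; apply: wN; exists w.
suff nvE : neighbours v = [set u]%classic.
  by rewrite /pendant nvE; exact: card_set1.
apply/seteqP; split=> [w /vu//|_ ->].
by have [w vw] := connected_has_neighbour v conG infG; rewrite /= -(vu w vw).
Qed.

Lemma pendant_finite_motion (G : sgraph) (v : G) :
  connected_graph G -> infinite_graph G -> pendant v ->
  exists phi : G -> G,
    [/\ endomorphism phi, phi <> id & finite_set (moved phi)].
Proof.
move=> conG infG /pendant_neighboursE[u vu vN].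
(* Otherwise no walk leaves the pair [v], [u], and the connected graph would be finite. *)
have [w uw wv] : exists2 w : G, adj u w & w <> v.
  apply: contrapT => wN; apply: infG.
  apply: (@sub_finite_set _ _ [set` [:: v; u]]%classic); last first.
    by apply/finite_seqP; exists [:: v; u].
  have uN (x : G) : adj u x -> x = v.
    by move=> ux; apply: contrapT => xv; apply: wN; exists x.
  have closed (p : seq G) (x : G) :
      x \in [:: v; u] -> path adj x p -> last x p \in [:: v; u].
    elim: p x => //= y p IHp x xvu /andP[xy]; apply: IHp.
    move: xvu xy; rewrite !inE.
    by move=> /orP[]/eqP-> => [/vN|/uN] ->; rewrite eqxx ?orbT.
  move=> x _ /=; have [p vp <-] := conG v x.
  by apply: closed; rewrite ?inE ?eqxx.
exists (fun x => if x == v then w else x); split.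
- move=> x y /=; case: eqP => [->|_]; case: eqP => [->|_] //.
  + by rewrite adj_irr.
  + by move=> /vN ->; rewrite adj_sym.
  + by rewrite adj_sym => /vN ->.
- by move=> /(congr1 (fun phi => phi v)) /=; rewrite eqxx.
- apply: (@sub_finite_set _ _ [set v]%classic); last exact: finite_set1.
  by move=> x; rewrite /moved /=; case: eqP.
Qed.

(** Vertices are prepended one at a time. A neighbour of the first vertex other than the second one
    exists, and acyclicity keeps it off the path. *)
Lemma path_extend_outside (G : sgraph) (s : seq G) (l : seq G) :
  is_tree G -> infinite_graph G -> ~ (exists v : G, pendant v) ->
  l <> [::] -> sorted adj l -> uniq l ->
  exists x p q, [/\ x \notin s, x :: p = q ++ l, path adj x p & uniq (x :: p)].
Proof.
move=> [_ conG acG] infG nopend l0 sl ul.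
(* One more new vertex than [s] has entries, so that one of them must lie outside [s]. *)
have [q [sq adjq uq]] : exists q,
    [/\ size q = (size s).+1, sorted adj (q ++ l) & uniq (q ++ l)].
  elim: (size s).+1 => [|n [q [<- sq uq]]]; first by exists [::].
  case ql: (q ++ l) sq uq => [|x p] /= xp up.
    by case: l0; case: (q) ql.
  (* On a one-vertex path the default makes this exclude [x] itself, which is harmless as [adj] is
     irreflexive. *)
  have [|w xw wp] := @no_pendant_other_neighbour G x (head x p) conG infG.
    by move=> px; apply: nopend; exists x.
  exists (w :: q); split=> //=; rewrite ql /= ?xp ?up ?andbT.
    by rewrite adj_sym.
  by apply/negP => /(acyclic_adj_path acG xp up xw).
have [y yq yNs] : exists2 y, y \in q & y \notin s.
  apply: contrapT => qs; suff: size q <= size s by rewrite sq ltnn.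
  apply: uniq_leq_size; first by move: uq; rewrite cat_uniq => /and3P[].
  by move=> y yq; apply: contrapT => /negP yNs; apply: qs; exists y.
(* Cutting off everything before [y] makes it the new endpoint. *)
case/splitPr: yq sq adjq uq => q1 q2 _; rewrite -catA => adjq uq.
exists y, (q2 ++ l), (y :: q2); split=> //.
- by move: adjq => /cat_sorted2[].
- by move: uq; rewrite cat_uniq => /and3P[].
Qed.

Theorem theorem13 (T : sgraph) (treeT : is_tree T) (infT : infinite_graph T) :
  infinite_endomorphism_motion T <-> ~ (exists v : T, pendant v).
Proof.
have [_ conT acT] := treeT; split=> [motT [v /pendant_finite_motion]|nopend].
  by move=> /(_ conT infT)[phi [phiE phiN /(motT _ phiE phiN)]].
move=> phi phiE phiN /finite_seqP[s sE]; apply: phiN; apply/funext => v.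
have fixed x : x \notin s -> phi x = x.
  move=> xNs; apply: contrapT => xm; move: xNs => /negP; apply.
  by have : moved phi x by []; rewrite sE.
have [a [p [q1 [aNs apE ap ua]]]] :=
  @path_extend_outside T s [:: v] treeT infT nopend ltac:(by []) isT isT.
(* Extension only works at the front, so the path is reversed to treat its other end; [a] is then
   the last vertex. *)
have [|||b [m [q2 [bNs bmE bm ub]]]] :=
  @path_extend_outside T s (rev (a :: p)) treeT infT nopend.
- by move=> /(congr1 size); rewrite size_rev.
- by rewrite rev_sorted; apply: sub_path ap => x y; rewrite adj_sym.
- by rewrite rev_uniq.
have lastm : last b m = a.
  have -> : last b m = last b (b :: m) by [].
  by rewrite bmE last_cat rev_cons last_rcons.
have phim : m = map phi m.
  apply: (acyclic_walk_eq acT bm ub).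
  - rewrite -{1}(fixed b bNs) path_map.
    by apply: sub_path bm => x y; exact: phiE.
  - by rewrite -{2}(fixed b bNs) last_map lastm fixed.
  - by rewrite size_map.
have : v \in b :: m.
  by rewrite bmE mem_cat mem_rev apE mem_cat mem_head !orbT.
rewrite inE => /orP[/eqP->|vm]; first exact: fixed.
(* Compare [m] and [map phi m] at the position of [v]. *)
have := vm; rewrite -index_mem => im.
by rewrite -{1}(nth_index b vm) -(nth_map b b) // -phim nth_index.
Qed.
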